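(* Let $G$ be a finite simple graph with no isolated vertices. Then the switching class of $\mathcal A(G)$ determines $G$ up to isomorphism: if $G$ and $H$ are finite simple graphs with no isolated vertices and the switching classes of $\mathcal A(G)$ and $\mathcal A(H)$ are the same up to relabelling of vertices (i.e. $\mathcal A(G)$ is isomorphic, as a signed graph, to a signed graph switching equivalent to $\mathcal A(H)$), then $G\cong H$. In general, for arbitrary finite simple graphs, the switching class of $\mathcal A(G)$ determines $G$ up to isomorphism modulo isolated vertices: if $G$ and $H$ are finite simple graphs whose switching classes of $\mathcal A(G)$ and $\mathcal A(H)$ are the same up to relabelling of vertices, then the graphs obtained from $G$ and $H$ by deleting all isolated vertices are isomorphic.
   Context: All graphs are finite, simple and undirected. Fix an arbitrary orientation of the edges of $G=(V,E)$. The oriented incidence matrix $D$ is the $|V|\times|E|$ matrix with $D_{ve}=+1$ if $v$ is the head of $e$, $D_{ve}=-1$ if $v$ is the tail of $e$, and $D_{ve}=0$ otherwise. The antisymmetric line graph $\mathcal A(G)$ is the signed graph with vertex set $E(G)$ and signed adjacency matrix $A_{\mathcal A(G)}=D^{\mathsf T}D-2I$: two distinct edges are adjacent iff they share an endpoint, with sign $+1$ if both enter or both leave the common vertex, and sign $-1$ if one enters and the other leaves. Switching a signed graph at a vertex reverses the signs of all edges incident to it; two signed graphs on the same underlying graph are switching equivalent if one is obtained from the other by a sequence of switchings, and the equivalence class is the switching class. Different orientations of $G$ give switching-equivalent signed graphs, so the switching class of $\mathcal A(G)$ depends only on $G$. *)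

(* Defs.v *)
From HB Require Import structures.
From mathcomp Require Import all_boot all_order all_algebra.
Set Implicit Arguments.
Unset Strict Implicit.
Unset Printing Implicit Defensive.
Import Order.TTheory GRing.Theory Num.Theory.
Local Open Scope ring_scope.

Record sgraph := SGraph {
  vert :> finType;
  adj : rel vert;
  adj_sym : symmetric adj;
  adj_irr : irreflexive adj }.

Definition graph_iso (G H : sgraph) : Prop :=
  exists2 f : G -> H, bijective f & forall x y : G, adj (f x) (f y) = adj x y.

Definition isolated (G : sgraph) (x : G) : bool := [forall y : G, ~~ adj x y].

Definition no_isolated (G : sgraph) : Prop := forall x : G, ~~ isolated x.

Section Induced.
Variables (G : sgraph) (A : {set G}).

Definition induced_adj (x y : {x : G | x \in A}) : bool := adj (val x) (val y).

Lemma induced_sym : symmetric induced_adj.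
Proof. by move=> x y; exact: adj_sym. Qed.

Lemma induced_irr : irreflexive induced_adj.
Proof. by move=> x; exact: adj_irr. Qed.

Definition induced : sgraph := SGraph induced_sym induced_irr.
End Induced.

Definition delete_isolated (G : sgraph) : sgraph :=
  induced [set x : G | ~~ isolated x].

Definition edges (G : sgraph) : {set {set G}} :=
  [set e | [exists x : G, exists y : G, adj x y && (e == [set x; y])]].

Definition edge (G : sgraph) : finType := {e : {set G} | e \in edges G}.

(* Distinctness of the two ends is automatic, an edge having two elements. *)
Record orientation (G : sgraph) := Orientation {
  head : edge G -> G;
  tail : edge G -> G;
  orientationP : forall e : edge G, val e = [set head e; tail e] }.

Lemma edge_ends (G : sgraph) (e : edge G) :
  exists p : G * G, val e == [set p.1; p.2].
Proof.
have := valP e; rewrite inE => /existsP[x /existsP[y /andP[_ exy]]].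
by exists (x, y).
Qed.

Lemma orientation_exists (G : sgraph) : inhabited (orientation G).
Proof.
pose p (e : edge G) := xchoose (edge_ends e).
constructor; apply: (@Orientation G (fun e => (p e).1) (fun e => (p e).2)) => e.
exact/eqP/(xchooseP (edge_ends e)).
Qed.

Lemma head_neq_tail (G : sgraph) (o : orientation G) (e : edge G) :
  head o e != tail o e.
Proof.
apply/eqP => ht; have := valP e.
rewrite inE => /existsP[x /existsP[y /andP[xy /eqP exy]]].
have := orientationP o e; rewrite ht setUid exy => E.
have /set1P xt : x \in [set tail o e] by rewrite -E !inE eqxx.
have /set1P yt : y \in [set tail o e] by rewrite -E !inE eqxx orbT.
by move: xy; rewrite xt yt adj_irr.
Qed.

(* Rows and columns are indexed by ordinals, through the enumerations of the
   vertices and of the edges. *)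
Definition incidence_mx (G : sgraph) (o : orientation G) :
    'M[int]_(#|G|, #|edge G|) :=
  \matrix_(i, j)
    if enum_val i == head o (enum_val j) then 1
    else if enum_val i == tail o (enum_val j) then -1 else 0.

(* A signed graph is given by its signed adjacency matrix: [sgn u v] is the
   sign of the edge uv, or 0 if u and v are not adjacent. *)
Record signed_graph (V : finType) := SignedGraph {
  sgn : V -> V -> int;
  sgn_sym : forall u v, sgn u v = sgn v u;
  sgn_diag : forall u, sgn u u = 0;
  sgn_range : forall u v, sgn u v \in [:: -1; 0; 1] }.

Definition signed_iso (V W : finType) (S : signed_graph V)
    (T : signed_graph W) : Prop :=
  exists2 f : V -> W, bijective f & forall u v, sgn T (f u) (f v) = sgn S u v.

Section Switching.
Variables (V : finType) (w : V) (S : signed_graph V).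

Definition switch_sgn (u v : V) : int :=
  if (u == w) (+) (v == w) then - sgn S u v else sgn S u v.

Lemma switch_sym u v : switch_sgn u v = switch_sgn v u.
Proof. by rewrite /switch_sgn addbC sgn_sym. Qed.

Lemma switch_diag u : switch_sgn u u = 0.
Proof. by rewrite /switch_sgn addbb sgn_diag. Qed.

Lemma switch_range u v : switch_sgn u v \in [:: -1; 0; 1].
Proof.
rewrite /switch_sgn; case: ifP => _; last exact: sgn_range.
by have := sgn_range S u v; rewrite !inE => /or3P[] /eqP ->.
Qed.

Definition switch : signed_graph V :=
  SignedGraph switch_sym switch_diag switch_range.
End Switching.

Definition switching_equivalent (V : finType) (S T : signed_graph V) : Prop :=
  exists s : seq V, forall u v, sgn (foldr (@switch V) S s) u v = sgn T u v.

Definition same_switching_class (V W : finType) (S : signed_graph V)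
    (T : signed_graph W) : Prop :=
  exists2 T' : signed_graph W, switching_equivalent T T' & signed_iso S T'.

Section AntisymmetricLineGraph.
Variables (G : sgraph) (o : orientation G).

Definition antisym_line_mx : 'M[int]_#|edge G| :=
  (incidence_mx o)^T *m incidence_mx o - 2%:M.

Definition antisym_line_sgn (e f : edge G) : int :=
  antisym_line_mx (enum_rank e) (enum_rank f).

Lemma antisym_line_sgnE (e f : edge G) : antisym_line_sgn e f =
  incidence_mx o (enum_rank (head o e)) (enum_rank f)
  - incidence_mx o (enum_rank (tail o e)) (enum_rank f) - (2 *+ (e == f)).
Proof.
rewrite /antisym_line_sgn !mxE (inj_eq enum_rank_inj); congr (_ - _).
have ht := head_neq_tail o e.
have nr : enum_rank (tail o e) != enum_rank (head o e).
  by rewrite (inj_eq enum_rank_inj) eq_sym.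
rewrite (bigD1 (enum_rank (head o e))) //= (bigD1 (enum_rank (tail o e))) //=.
rewrite big1 => [|i /andP[ih it]].
  by rewrite !mxE !enum_rankK !eqxx [tail o e == head o e]eq_sym (negPf ht)
    mul1r mulN1r addr0.
rewrite !mxE enum_rankK.
by rewrite -(inj_eq enum_rank_inj) enum_valK (negPf ih)
  -(inj_eq enum_rank_inj) enum_valK (negPf it) mul0r.
Qed.

Lemma antisym_line_sym e f : antisym_line_sgn e f = antisym_line_sgn f e.
Proof.
have Mt : antisym_line_mx^T = antisym_line_mx.
  by rewrite /antisym_line_mx linearB /= trmx_mul trmxK tr_scalar_mx.
by rewrite /antisym_line_sgn -{1}Mt mxE.
Qed.

Lemma antisym_line_diag e : antisym_line_sgn e e = 0.
Proof.
rewrite antisym_line_sgnE !mxE !enum_rankK !eqxx.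
by rewrite [tail o e == _]eq_sym (negPf (head_neq_tail o e)).
Qed.

Lemma antisym_line_range e f : antisym_line_sgn e f \in [:: -1; 0; 1].
Proof.
have [->|nef] := eqVneq e f; first by rewrite antisym_line_diag.
rewrite antisym_line_sgnE !mxE !enum_rankK (negPf nef).
have he := head_neq_tail o e; have hf := head_neq_tail o f.
have : val e != val f by rewrite (inj_eq val_inj).
rewrite !(orientationP o).
have [a|_] := eqVneq (head o e) (head o f).
  have [b|_] := eqVneq (tail o e) (head o f); first by rewrite a b eqxx in he.
  have [c|_] := eqVneq (tail o e) (tail o f); last by [].
  by rewrite a c eqxx.
have [a|_] := eqVneq (head o e) (tail o f).
  have [b|_] := eqVneq (tail o e) (head o f).
    by rewrite a b setUC eqxx.
  have [c|_] := eqVneq (tail o e) (tail o f); last by [].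
  by rewrite a c eqxx in he.
have [b|_] := eqVneq (tail o e) (head o f); first by [].
by have [c|_] := eqVneq (tail o e) (tail o f).
Qed.

Definition antisym_line : signed_graph (edge G) :=
  SignedGraph antisym_line_sym antisym_line_diag antisym_line_range.
End AntisymmetricLineGraph.

(* Main.v *)
(** Switching does not change the sign of a triangle, three edges through a
    vertex make a positive triangle, and the three sides of a triangle of the
    graph make a negative one.  Hence a signed isomorphism is a bijection [phi]
    between the edges such that any three edges have a common endpoint iff their
    images do.  Such a [phi] maps the star of a vertex of degree at least 2 onto
    a star, and so does its inverse; looking at the two ends of each edge, [phi]
    maps the stars of the ends of [e] onto those of the ends of [phi e].  Choosing
    one edge for each star turns this into an injection between the non-isolated
    vertices, which is bijective because there is another one backwards. *)
Require Import Defs.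
From mathcomp Require Import all_boot all_order all_algebra.
From mathcomp Require Import ring.
Set Implicit Arguments.
Unset Strict Implicit.
Unset Printing Implicit Defensive.
Import Order.TTheory GRing.Theory Num.Theory.
Local Open Scope ring_scope.

(* Otherwise [head] is that of [seq]. *)
Local Notation head := Defs.head.

(** * Graph isomorphisms *)

Lemma graph_iso_sym (G H : sgraph) : graph_iso G H -> graph_iso H G.
Proof.
move=> [f [g fK gK] fadj]; exists g; first by exists f.
by move=> x y; rewrite -fadj !gK.
Qed.

Lemma graph_iso_trans (G H K : sgraph) :
  graph_iso G H -> graph_iso H K -> graph_iso G K.
Proof.
move=> [f f_bij fadj] [g g_bij gadj]; exists (g \o f); first exact: bij_comp.
by move=> x y; rewrite /= gadj fadj.
Qed.

Lemma delete_isolated_iso (G : sgraph) :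
  no_isolated G -> graph_iso (delete_isolated G) G.
Proof.
move=> noG.
have memG (x : G) : x \in [set x : G | ~~ isolated x] by rewrite inE noG.
exists val => //.
by exists (fun x => Sub x (memG x)) => x; [exact: val_inj | exact: SubK].
Qed.

(** * Stars and concurrent edges *)

Section Edges.
Variable G : sgraph.
Implicit Types (e f g : edge G) (x y v : G).

Definition star v : {set edge G} := [set e : edge G | v \in val e].

Lemma edge_set2 e x y :
  x \in val e -> y \in val e -> x != y -> val e = [set x; y].
Proof.
have := valP e; rewrite inE => /existsP[a /existsP[b /andP[_ /eqP ->]]].
rewrite !inE => /orP[]/eqP-> /orP[]/eqP->; rewrite ?eqxx //.
by rewrite setUC.
Qed.

Lemma edge_eq e f x y : x != y ->
  x \in val e -> y \in val e -> x \in val f -> y \in val f -> e = f.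
Proof.
move=> xy xe ye xf yf; apply: val_inj.
by rewrite (edge_set2 xe ye xy) (edge_set2 xf yf xy).
Qed.

Lemma common_end_eq e f x y : e != f ->
  x \in val e -> x \in val f -> y \in val e -> y \in val f -> x = y.
Proof.
move=> ef xe xf ye yf; apply/eqP; apply: contraNT ef => xy.
by rewrite (edge_eq xy xe ye xf yf).
Qed.

(** Puts adjacency in terms of edges, so that a bijection between edges can transport it. *)
Lemma adj_edgeP x y :
  reflect (x != y /\ exists e, (x \in val e) && (y \in val e)) (adj x y).
Proof.
apply: (iffP idP) => [xy | [xy [e /andP[xe ye]]]].
  split; first by apply: contraTneq xy => ->; rewrite adj_irr.
  have xyE : [set x; y] \in edges G.
    rewrite inE; apply/existsP; exists x; apply/existsP; exists y.
    by rewrite xy /=.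
  by exists (Sub [set x; y] xyE); rewrite SubK !inE !eqxx orbT.
have := valP e; rewrite inE => /existsP[a /existsP[b /andP[ab /eqP eE]]].
move: xe ye xy; rewrite eE !inE.
move=> /orP[]/eqP-> /orP[]/eqP->; rewrite ?eqxx // => _.
by rewrite adj_sym.
Qed.

Lemma isolatedPn x : reflect (exists e, e \in star x) (~~ isolated x).
Proof.
apply: (iffP idP) => [|[e]].
  rewrite /isolated negb_forall => /existsP[y /[!negbK]].
  move=> /adj_edgeP[_ [e /andP[xe _]]].
  by exists e; rewrite inE.
rewrite inE => xe; have [o] := orientation_exists G.
have ht := head_neq_tail o e; have hte := orientationP o e.
have [he te] : head o e \in val e /\ tail o e \in val e.
  by rewrite hte !inE !eqxx orbT.
rewrite /isolated negb_forall; apply/existsP.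
move: (xe); rewrite {1}hte !inE => /orP[]/eqP xE.
  exists (tail o e); rewrite negbK; apply/adj_edgeP; split; first by rewrite xE.
  by exists e; rewrite xe te.
exists (head o e); rewrite negbK; apply/adj_edgeP; split.
  by rewrite xE eq_sym.
by exists e; rewrite xe he.
Qed.

(** Repetitions are allowed: [concurrent e f f] says that [e] and [f] meet. *)
Definition concurrent e f g : bool :=
  [exists v : G, [&& v \in val e, v \in val f & v \in val g]].

Lemma concurrent_eef e f : concurrent e e f = concurrent e f f.
Proof. by apply: eq_existsb => v; rewrite andbb andbA andbb. Qed.

Lemma concurrent_efe e f : concurrent e f e = concurrent e f f.
Proof.
by apply: eq_existsb => v; case: (v \in val e); rewrite ?andbT ?andbb.
Qed.

End Edges.

(** * Concurrency read off from the signs *)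

Section Signs.
Variables (G : sgraph) (o : orientation G).
Implicit Types (e f g : edge G) (u v : G).

Definition incidence v e : int :=
  if v == head o e then 1 else if v == tail o e then -1 else 0.

Lemma head_in e : head o e \in val e.
Proof. by rewrite [val e](orientationP o) !inE eqxx. Qed.

Lemma tail_in e : tail o e \in val e.
Proof. by rewrite [val e](orientationP o) !inE eqxx orbT. Qed.

Lemma incidence_sqr v e : v \in val e -> incidence v e * incidence v e = 1.
Proof.
rewrite [val e](orientationP o) !inE /incidence.
by case: (v == head o e); case: (v == tail o e).
Qed.

Lemma incidence_out v e : v \notin val e -> incidence v e = 0.
Proof.
rewrite [val e](orientationP o) !inE /incidence.
by case: (v == head o e); case: (v == tail o e).
Qed.

Lemma incidence_opp u v e : u \in val e -> v \in val e -> u != v ->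
  incidence u e * incidence v e = -1.
Proof.
have := head_neq_tail o e; rewrite /incidence.
rewrite [val e](orientationP o) !inE => ht.
move=> /orP[]/eqP-> /orP[]/eqP->; rewrite ?eqxx //.
  by rewrite [tail o e == _]eq_sym (negPf ht).
by rewrite [tail o e == _]eq_sym (negPf ht).
Qed.

Lemma antisym_lineE e f : e != f -> sgn (antisym_line o) e f =
  incidence (head o e) f - incidence (tail o e) f.
Proof.
move=> ef; rewrite /= antisym_line_sgnE (negPf ef) mulr0n subr0.
by rewrite !mxE !enum_rankK.
Qed.

(** Distinct edges share at most one vertex, so the end of [e] other than [v] contributes 0. *)
Lemma antisym_line_meet v e f : e != f -> v \in val e -> v \in val f ->
  sgn (antisym_line o) e f = incidence v e * incidence v f.
Proof.
move=> ef ve vf; rewrite (antisym_lineE ef).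
have ht := head_neq_tail o e.
have out w : w \in val e -> w != v -> incidence w f = 0.
  move=> we wv; apply: incidence_out; apply: contraNN wv => wf.
  by rewrite (common_end_eq ef we wf ve vf).
move: (ve); rewrite {1}[val e](orientationP o) !inE => /orP[]/eqP vE; subst v.
  rewrite (out (tail o e)) ?tail_in //; last by rewrite eq_sym.
  by rewrite subr0 {2}/incidence eqxx mul1r.
rewrite (out (head o e)) ?head_in // sub0r {2}/incidence.
by rewrite [tail o e == head o e]eq_sym (negPf ht) eqxx mulN1r.
Qed.

Lemma antisym_line_disjoint e f :
  (forall v, v \in val e -> v \notin val f) -> e != f ->
  sgn (antisym_line o) e f = 0.
Proof.
move=> dis ef; rewrite (antisym_lineE ef).
by rewrite !incidence_out ?dis ?head_in ?tail_in // subr0.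
Qed.

Lemma concurrent_pair e f : e != f ->
  concurrent e f f = (sgn (antisym_line o) e f != 0).
Proof.
move=> ef; apply/existsP/idP => [[v /and3P[ve vf _]]|].
  (* The product squares to 1, hence is nonzero. *)
  rewrite (antisym_line_meet ef ve vf); apply/eqP => z.
  have := mulrACA (incidence v e) (incidence v f)
    (incidence v e) (incidence v f).
  by rewrite z (incidence_sqr ve) (incidence_sqr vf) mul0r.
move=> nz; apply/existsP; apply: contraNT nz => /existsPn nex.
rewrite antisym_line_disjoint // => v ve.
by apply: contraNN (nex v) => vf; rewrite ve vf.
Qed.

(** At a common vertex every incidence occurs squared, giving 1. Around a triangle of the graph each
    edge contributes the product of the incidences of its two ends, giving -1 three times. *)
Lemma concurrent_triangle e f g : e != f -> f != g -> g != e ->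
  concurrent e f g =
  (sgn (antisym_line o) e f * sgn (antisym_line o) f g
   * sgn (antisym_line o) g e == 1).
Proof.
move=> ef fg ge; apply/existsP/eqP => [[v /and3P[ve vf vg]]|prod1].
  rewrite (antisym_line_meet ef ve vf) (antisym_line_meet fg vf vg).
  rewrite (antisym_line_meet ge vg ve).
  have := incidence_sqr ve; have := incidence_sqr vf; have := incidence_sqr vg.
  move: (incidence v e) (incidence v f) (incidence v g) => a b c cc bb aa.
  have -> : a * b * (b * c) * (c * a) = (a * a) * (b * b) * (c * c) by ring.
  by rewrite aa bb cc.
(* A product equal to 1 has nonzero factors, so the edges meet pairwise, in [a], [b], [c]; if two of
   these coincide, that vertex lies on all three edges. *)
have [nef nfg nge] : [/\ sgn (antisym_line o) e f != 0,
    sgn (antisym_line o) f g != 0 & sgn (antisym_line o) g e != 0].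
  by split; apply: contra_eq_neq prod1 => ->; rewrite ?(mulr0, mul0r).
move: (nef); rewrite -concurrent_pair // => /existsP[b /and3P[be bf _]].
move: (nfg); rewrite -concurrent_pair // => /existsP[c /and3P[cf cg _]].
move: (nge); rewrite -concurrent_pair // => /existsP[a /and3P[ag ae _]].
have [ab|ab] := eqVneq a b; first by exists b; rewrite be bf -ab ag.
have [bc|bc] := eqVneq b c; first by exists b; rewrite be bf bc cg.
have [ca|ca] := eqVneq c a; first by exists c; rewrite cf cg ca ae.
move: prod1; rewrite (antisym_line_meet ef be bf) (antisym_line_meet fg cf cg).
rewrite (antisym_line_meet ge ag ae).
have := incidence_opp ae be ab; have := incidence_opp bf cf bc.
have := incidence_opp cg ag ca.
set ie := incidence b e; set jf := incidence b f; set kf := incidence c f.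
set lg := incidence c g; set mg := incidence a g; set ne := incidence a e.
move=> hg hf he.
(* Regroup by edges instead of by vertices. *)
have -> : ie * jf * (kf * lg) * (mg * ne) = (ne * ie) * (jf * kf) * (lg * mg).
  by ring.
by rewrite hg hf he.
Qed.

End Signs.

(** * Invariance under switching *)

(** [t u] is -1 to the number of switchings at [u]. *)
Lemma switching_signs (V : finType) (S T : signed_graph V) :
  switching_equivalent S T ->
  exists2 t : V -> int, (forall u, t u * t u = 1)
    & forall u v, sgn T u v = t u * t v * sgn S u v.
Proof.
case=> s sE.
suff [t tt tE] : exists2 t : V -> int, (forall u, t u * t u = 1)
    & forall u v, sgn (foldr (@switch V) S s) u v = t u * t v * sgn S u v.
  by exists t => // u v; rewrite -sE tE.
elim: s {sE} => [|w s [t tt tE]].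
  by exists (fun=> 1) => // u v; rewrite !mul1r.
exists (fun u => if u == w then - t u else t u) => [u|u v].
  by case: ifP; rewrite ?mulrNN.
rewrite /= /switch_sgn tE.
by case: (u == w); case: (v == w); rewrite /= ?(mulrN, mulNr, opprK).
Qed.

(** The factors [t] do not affect whether a sign vanishes, and each occurs twice in the product
    around a triangle. *)
Lemma switching_concurrent (G H : sgraph) (oG : orientation G)
    (oH : orientation H) :
  same_switching_class (antisym_line oG) (antisym_line oH) ->
  exists2 phi : edge G -> edge H, bijective phi
    & forall e f g, concurrent (phi e) (phi f) (phi g) = concurrent e f g.
Proof.
case=> T' /switching_signs[t tt tE] [phi phi_bij phiE].
have phi_inj := bij_inj phi_bij; exists phi => //.
have sE e f : sgn (antisym_line oG) e f =
    t (phi e) * t (phi f) * sgn (antisym_line oH) (phi e) (phi f).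
  by rewrite -phiE tE.
have t0 u : t u != 0.
  by apply/eqP => tu; have := tt u; rewrite tu mul0r.
have pair e f : concurrent (phi e) (phi f) (phi f) = concurrent e f f.
  have [->|ef] := eqVneq e f.
    transitivity true; last symmetry; apply/existsP.
      by exists (head oH (phi f)); rewrite head_in.
    by exists (head oG f); rewrite head_in.
  rewrite (concurrent_pair oG) // (concurrent_pair oH) ?inj_eq // sE.
  by rewrite !mulf_eq0 !(negPf (t0 _)).
move=> e f g.
(* Triples with a repetition reduce to pairs. *)
have [<-|fg] := eqVneq f g; first exact: pair.
have [<-|ef] := eqVneq e f; first by rewrite !concurrent_eef.
have [->|ge] := eqVneq g e; first by rewrite !concurrent_efe.
rewrite (concurrent_triangle oG) // (concurrent_triangle oH) ?inj_eq // !sE.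
have cancel_squares (a b c x y z : int) : a * a = 1 -> b * b = 1 -> c * c = 1 ->
    a * b * x * (b * c * y) * (c * a * z) = x * y * z.
  move=> aa bb cc.
  have -> : a * b * x * (b * c * y) * (c * a * z) =
    (a * a) * (b * b) * (c * c) * (x * y * z) by ring.
  by rewrite aa bb cc !mul1r.
by rewrite cancel_squares.
Qed.

(** * Images of stars *)

(** With a second edge [e'] at [x], the star of [x] consists of the edges concurrent with [e] and
    [e']. Their images meet in exactly one vertex [p], whose star is described likewise. *)
Lemma star_image (G H : sgraph) (phi : edge G -> edge H)
    (psi : edge H -> edge G) (phiK : cancel phi psi) (psiK : cancel psi phi)
    (phi3 : forall e f g, concurrent (phi e) (phi f) (phi g) = concurrent e f g)
    (x : G) (e : edge G) : x \in val e -> star x != [set e] ->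
  exists2 p, p \in val (phi e) & star p = phi @: star x.
Proof.
move=> ex nleaf.
have [e' ex' ee'] : exists2 e' : edge G, x \in val e' & e != e'.
  apply/exists_inP; apply: contraNT nleaf => /exists_inPn none.
  apply/eqP/setP => f; rewrite !inE; apply/idP/eqP => [/none|->//].
  by rewrite negbK => /eqP.
have : concurrent (phi e) (phi e') (phi e').
  by rewrite phi3; apply/existsP; exists x; rewrite ex ex'.
move=> /existsP[p /and3P[pe pe' _]]; exists p => //.
have pee' : phi e != phi e' by rewrite (can_eq phiK).
apply/setP => d; rewrite -[d]psiK (mem_imset _ _ (can_inj phiK)) !inE.
apply/idP/idP => h.
  have : concurrent e e' (psi d).
    by rewrite -phi3; apply/existsP; exists p; rewrite pe pe' h.
  move=> /existsP[y /and3P[ye ye' yd]].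
  by rewrite (common_end_eq ee' ex ex' ye ye').
have : concurrent (phi e) (phi e') (phi (psi d)).
  by rewrite phi3; apply/existsP; exists x; rewrite ex ex' h.
move=> /existsP[q /and3P[qe qe' qd]].
by rewrite (common_end_eq pee' pe pe' qe qe').
Qed.

(** Every edge at [x] also contains [y], so it is [e]: the edge forms a component by itself. *)
Lemma star_eq_leaf (G : sgraph) (x y : G) (e : edge G) :
  x != y -> x \in val e -> star x = star y -> star x = [set e].
Proof.
move=> xy xe xyE.
have starE (f : edge G) : (x \in val f) = (y \in val f).
  by move/setP/(_ f): xyE; rewrite !inE.
apply/setP => f; rewrite !inE; apply/idP/eqP => [xf|->//].
by apply: (edge_eq xy); rewrite -?starE.
Qed.

(** * Matching the ends of an edge with those of its image *)

Section EndMap.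
Variables (G H : sgraph) (phi : edge G -> edge H) (psi : edge H -> edge G).
Hypotheses (phiK : cancel phi psi) (psiK : cancel psi phi).
Hypothesis phi3 :
  forall e f g, concurrent (phi e) (phi f) (phi g) = concurrent e f g.
Variables (oG : orientation G) (oH : orientation H).

Lemma star_preimage (e : edge G) (p : H) :
  p \in val (phi e) -> star p != [set phi e] ->
  exists2 x, x \in val e & star p = phi @: star x.
Proof.
have psi3 d f g : concurrent (psi d) (psi f) (psi g) = concurrent d f g.
  by rewrite -phi3 !psiK.
move=> pe nleaf; have [x] := star_image psiK phiK psi3 pe nleaf.
rewrite phiK => xe xE; exists x => //.
by rewrite xE -imset_comp (eq_imset _ (psiK : phi \o psi =1 id)) imset_id.
Qed.

(** If [y] has degree at least 2, its star goes to that of [p] or [q]; were it [p], then [x] and [y]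
    would have equal stars and [y] would be a leaf. If [y] is a leaf, the same argument backwards
    shows that [q] is one. *)
Lemma star_other_end (e : edge G) (x y : G) (p q : H) :
  x \in val e -> y \in val e -> x != y ->
  p \in val (phi e) -> q \in val (phi e) -> p != q ->
  star p = phi @: star x -> star q = phi @: star y.
Proof.
move=> xe ye xy pe qe pq pE.
have [yleaf|ynleaf] := eqVneq (star y) [set e].
  rewrite yleaf imset_set1; apply/eqP; apply: contraT => qnleaf.
  have [v ve vE] := star_preimage qe qnleaf.
  move: ve; rewrite (edge_set2 xe ye xy) !inE => /orP[]/eqP vz; subst v.
    have qp : q != p by rewrite eq_sym.
    by rewrite (star_eq_leaf qp qe) ?eqxx // vE in qnleaf.
  by rewrite vE yleaf imset_set1 eqxx in qnleaf.
have [q' q'e q'E] := star_image phiK psiK phi3 ye ynleaf.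
move: q'e; rewrite (edge_set2 pe qe pq) !inE => /orP[]/eqP q'z; subst q' => //.
have yxE : star y = star x.
  by apply: (imset_inj (can_inj phiK)); rewrite -q'E.
have yx : y != x by rewrite eq_sym.
by rewrite (star_eq_leaf yx ye yxE) eqxx in ynleaf.
Qed.

(** Only a leaf needs care: either the tail has degree at least 2 and is matched first, or [e] is a
    component and so is [phi e]. *)
Lemma star_image_head (e : edge G) :
  exists2 p, p \in val (phi e) & star p = phi @: star (head oG e).
Proof.
have [he te ht] := And3 (head_in oG e) (tail_in oG e) (head_neq_tail oG e).
have th : tail oG e != head oG e by rewrite eq_sym.
have [hE tE HT] :=
  And3 (head_in oH (phi e)) (tail_in oH (phi e)) (head_neq_tail oH (phi e)).
have TH : tail oH (phi e) != head oH (phi e) by rewrite eq_sym.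
have [hleaf|] := eqVneq (star (head oG e)) [set e]; last exact: star_image.
have [tleaf|tnleaf] := eqVneq (star (tail oG e)) [set e].
  exists (head oH (phi e)) => //; rewrite hleaf imset_set1; apply/eqP.
  apply: contraT => nleaf; have [v ve vE] := star_preimage hE nleaf.
  rewrite vE in nleaf; move: ve nleaf.
  rewrite (edge_set2 he te ht) !inE => /orP[]/eqP->.
    by rewrite hleaf imset_set1 eqxx.
  by rewrite tleaf imset_set1 eqxx.
have [q qe qE] := star_image phiK psiK phi3 te tnleaf.
move: (qe); rewrite {1}(edge_set2 hE tE HT) !inE => /orP[]/eqP qz; subst q.
  by exists (tail oH (phi e)) => //; apply: star_other_end te he th hE tE HT qE.
by exists (head oH (phi e)) => //; apply: star_other_end te he th tE hE TH qE.
Qed.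

(** The outer [==] is a biconditional: heads go to heads if their stars match, otherwise the ends
    are swapped. It is meant for [x] on [e]. *)
Definition end_map (e : edge G) (x : G) : H :=
  if (star (head oH (phi e)) == phi @: star (head oG e)) == (x == head oG e)
  then head oH (phi e) else tail oH (phi e).

Lemma star_end_map (e : edge G) (x : G) :
  x \in val e -> star (end_map e x) = phi @: star x.
Proof.
have [he te ht] := And3 (head_in oG e) (tail_in oG e) (head_neq_tail oG e).
have [hE tE HT] :=
  And3 (head_in oH (phi e)) (tail_in oH (phi e)) (head_neq_tail oH (phi e)).
have TH : tail oH (phi e) != head oH (phi e) by rewrite eq_sym.
have [p pe pE] := star_image_head e; rewrite /end_map.
case: (star _ =P _) => [hhE|nhhE]; rewrite {1}(edge_set2 he te ht) !inE.
  case/orP=> /eqP->; rewrite ?eqxx /= ?eqxx //.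
  rewrite [tail oG e == _]eq_sym (negPf ht).
  exact: star_other_end he te ht hE tE HT hhE.
(* The matched end [p] is not the head, so it is the tail. *)
have thE : star (tail oH (phi e)) = phi @: star (head oG e).
  by move: pe; rewrite (edge_set2 hE tE HT) !inE => /orP[]/eqP pz; subst p.
case/orP=> /eqP->; rewrite ?eqxx /= ?eqxx //.
rewrite [tail oG e == _]eq_sym (negPf ht).
exact: star_other_end he te ht tE hE TH thE.
Qed.

(** Needed when both ends of [e] have the same star, so that stars cannot separate them. *)
Lemma end_map_inj (e : edge G) (x y : G) : x \in val e -> y \in val e ->
  end_map e x = end_map e y -> x = y.
Proof.
have ht := head_neq_tail oG e; have HT := head_neq_tail oH (phi e).
have TH : tail oH (phi e) == head oH (phi e) = false.
  by rewrite eq_sym (negPf HT).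
rewrite (edge_set2 (head_in oG e) (tail_in oG e) ht) !inE /end_map.
move=> /orP[]/eqP-> /orP[]/eqP-> //;
  rewrite eqxx [tail oG e == _]eq_sym (negPf ht).
  by case: (_ == phi @: _) => /eqP; rewrite ?TH ?(negPf HT).
by case: (_ == phi @: _) => /eqP; rewrite ?TH ?(negPf HT).
Qed.

(** * From edges back to vertices *)

Lemma delete_isolated_embedding :
  exists2 F : delete_isolated G -> delete_isolated H, injective F
    & forall x y, adj (F x) (F y) = adj x y.
Proof.
have ex (x : delete_isolated G) : exists e, e \in star (val x).
  by apply/isolatedPn; have := valP x; rewrite inE.
pose c x := xchoose (ex x).
have cP x : val x \in val (c x) by have := xchooseP (ex x); rewrite inE.
have starF x : star (end_map (c x) (val x)) = phi @: star (val x).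
  exact: star_end_map.
have memF x : end_map (c x) (val x) \in [set y : H | ~~ isolated y].
  rewrite inE; apply/isolatedPn; exists (phi (c x)).
  by rewrite starF imset_f // inE.
pose F x : delete_isolated H := Sub (end_map (c x) (val x)) (memF x).
have F_inj : injective F.
  move=> x y /(congr1 val); rewrite !SubK => xyE; apply: val_inj.
  have sxy : star (val x) = star (val y).
    by apply: (imset_inj (can_inj phiK)); rewrite -!starF xyE.
  (* [xchoose] depends only on the set chosen from, so equal stars give the same edge, on which
     [end_map] is injective. *)
  have cxy : c x = c y by apply: eq_xchoose => e; rewrite sxy.
  apply: (@end_map_inj (c x)); rewrite ?cP //; first by rewrite cxy.
  by rewrite xyE cxy.
exists F => // x y.
have vF z : val (F z) = end_map (c z) (val z) by [].
change (adj (val (F x)) (val (F y)) = adj (val x) (val y)).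
apply/adj_edgeP/adj_edgeP => -[ne [e /andP[xe ye]]].
  (* An edge through both vertices is carried back by [psi], and in the converse direction forward
     by [phi]. *)
  split; first by apply: contra_neq ne => /val_inj ->.
  exists (psi e); rewrite !vF in xe ye.
  have : e \in star (end_map (c x) (val x)) by rewrite inE.
  have : e \in star (end_map (c y) (val y)) by rewrite inE.
  rewrite !starF -[e]psiK !(mem_imset _ _ (can_inj phiK)) !inE psiK.
  by move=> -> ->.
split; first by apply: contra_neq ne => /val_inj/F_inj ->.
exists (phi e); rewrite !vF.
have : phi e \in star (end_map (c x) (val x)) by rewrite starF imset_f ?inE.
have : phi e \in star (end_map (c y) (val y)) by rewrite starF imset_f ?inE.
by rewrite !inE => -> ->.
Qed.

End EndMap.

Theorem theorem3 (G H : sgraph) (oG : orientation G) (oH : orientation H)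
    (hGH : same_switching_class (antisym_line oG) (antisym_line oH)) :
  (no_isolated G -> no_isolated H -> graph_iso G H)
  /\ graph_iso (delete_isolated G) (delete_isolated H).
Proof.
suff isoGH : graph_iso (delete_isolated G) (delete_isolated H).
  split=> // noG noH; apply: graph_iso_trans (delete_isolated_iso noH).
  exact: graph_iso_trans (graph_iso_sym (delete_isolated_iso noG)) isoGH.
have [phi [psi phiK psiK] phi3] := switching_concurrent hGH.
have psi3 d f g : concurrent (psi d) (psi f) (psi g) = concurrent d f g.
  by rewrite -phi3 !psiK.
have [F F_inj Fadj] := delete_isolated_embedding phiK psiK phi3 oG oH.
(* The backward injection bounds the cardinality, which makes [F] bijective. *)
have [F' F'_inj _] := delete_isolated_embedding psiK phiK psi3 oH oG.
exists F => //; apply: inj_card_bij => //; exact: leq_card F'_inj.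
Qed.
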